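(* Let $n\ge 2$ be an integer, $\Omega\ge 1$ a real number, and $\mathcal{B}=[\Omega^{-1},\Omega]^n$. Let $F\subset\mathcal{B}$ be a face with $m\ge 2$ free coordinates. Then for any fixed $u>0$, the restriction of $q(u;\cdot)$ to $F$ has no critical point in the relative interior of $F$.
   Context: For an integer $n\ge 1$, a real $u>0$ and a vector $\mathbf{r}=(r_1,\dots,r_n)$ of positive reals, define $$a_i(u;\mathbf{r})=\binom{n}{i}\Bigl(\prod_{j=1}^{i}r_j\Bigr)u^{i}\quad(0\le i\le n),\qquad p_i=\frac{a_i(u;\mathbf{r})}{\sum_{j=0}^{n}a_j(u;\mathbf{r})},\qquad \bar\mu=\sum_{j=0}^{n}j\,p_j,$$ where the empty product equals $1$, and $$q(u;\mathbf{r})=\frac{(1+u)^2}{n\,u}\sum_{i=0}^{n}(i-\bar\mu)^2p_i.$$ A face $F$ of $\mathcal{B}$ with free coordinates $r_{k_1},\dots,r_{k_m}$ ($1\le k_1<\dots<k_m\le n$) is the set of $\mathbf{r}\in\mathcal{B}$ whose free coordinates are arbitrary in $[\Omega^{-1},\Omega]$ and whose other coordinates are each frozen at a prescribed value in $\{\Omega^{-1},\Omega\}$. Its relative interior consists of the points of $F$ whose free coordinates all lie in the open interval $(\Omega^{-1},\Omega)$. A critical point of $q(u;\cdot)|_F$ in the relative interior is a point at which $\partial q/\partial r_{k_\alpha}=0$ for every $\alpha=1,\dots,m$. *)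

(* Defs.v *)
From HB Require Import structures.
From mathcomp Require Import all_boot all_order all_algebra.
From mathcomp Require Import all_classical all_reals all_analysis.

Set Implicit Arguments.
Unset Strict Implicit.
Unset Printing Implicit Defensive.
Import Order.TTheory GRing.Theory Num.Theory.
Import numFieldNormedType.Exports.

Local Open Scope classical_set_scope.
Local Open Scope ring_scope.

(* Coordinates are numbered from 0: r 0 j is the (j+1)-st coordinate of the row
   vector r, so the product below ranges over the first i coordinates. *)
Definition coef (R : realType) (n : nat) (u : R) (r : 'rV[R]_n) (i : nat) : R :=
  'C(n, i)%:R * (\prod_(j < n | (j < i)%N) r 0 j) * u ^+ i.

Definition weight (R : realType) (n : nat) (u : R) (r : 'rV[R]_n) (i : nat) : R :=
  coef u r i / \sum_(j < n.+1) coef u r j.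

Definition mean (R : realType) (n : nat) (u : R) (r : 'rV[R]_n) : R :=
  \sum_(j < n.+1) j%:R * weight u r j.

Definition q (R : realType) (n : nat) (u : R) (r : 'rV[R]_n) : R :=
  (1 + u) ^+ 2 / (n%:R * u) *
  \sum_(i < n.+1) (i%:R - mean u r) ^+ 2 * weight u r i.

Definition box (R : realType) (n : nat) (Omega : R) : set 'rV[R]_n :=
  [set r | forall k, Omega^-1 <= r 0 k <= Omega].

(* S is the set of free coordinates; the entries of c outside S are the frozen
   values, and its entries in S are irrelevant. *)
Definition face (R : realType) (n : nat) (Omega : R) (S : {set 'I_n})
    (c : 'rV[R]_n) : set 'rV[R]_n :=
  [set r | box Omega r /\ forall k, k \notin S -> r 0 k = c 0 k].

Definition face_relint (R : realType) (n : nat) (Omega : R) (S : {set 'I_n})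
    (c : 'rV[R]_n) : set 'rV[R]_n :=
  [set r | face Omega S c r /\ forall k, k \in S -> Omega^-1 < r 0 k < Omega].

(* The derivative of f along the k-th basis vector is its k-th partial
   derivative. *)
Definition critical_point (R : realType) (n : nat) (S : {set 'I_n})
    (f : 'rV[R]_n -> R) (r : 'rV[R]_n) : Prop :=
  forall k, k \in S -> 'D_(delta_mx 0 k) f r = 0.

(* Main.v *)
(* Up to a positive factor the partial derivative of q in the k-th coordinate is
   the tail sum over i > k of a_i g(i), where g(x) = (x - mu)^2 - V, mu is the
   mean and V the variance; the sum over all i vanishes too.  If two tails vanish,
   {0..n} splits into three consecutive nonempty blocks on each of which a_i g(i)
   sums to 0.  Hence g <= 0 somewhere in the outer blocks and g >= 0 somewhere in
   the middle one, which contradicts the strict convexity of g. *)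
Require Import Defs.
From mathcomp Require Import all_boot all_order all_algebra.
From mathcomp Require Import all_classical all_reals all_analysis.
From mathcomp Require Import ring lra.
Import Order.TTheory GRing.Theory Num.Theory.
Import numFieldNormedType.Exports.
Local Open Scope classical_set_scope.
Local Open Scope ring_scope.

(** Both sides are limits of the same difference quotient. This makes the one-variable [is_derive]
    rules available for partial derivatives. *)
Lemma derive_line {R : realType} {V W : normedModType R} (f : V -> W) (a v : V) :
  'D_v f a = 'D_1 (fun h : R => f (h *: v + a)) (0 : R).
Proof.
apply: (congr1 (fun F : R -> W => lim (F @ 0^'))); apply/funext => h /=.
by rewrite addr0 scale0r add0r [h *: 1]mulr1.
Qed.

(** Otherwise every term over [P] would be positive, and [i0] ensures that there is at least one. *)
Lemma exists_le0_of_sum0 {R : realDomainType} {I : finType} {P : pred I}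
    {a g : I -> R} {i0 : I} :
  P i0 -> (forall i, 0 < a i) -> \sum_(i | P i) a i * g i = 0 ->
  exists2 i, P i & g i <= 0.
Proof.
move=> Pi0 a_gt0 sum0; apply/exists_inP; apply: contra_eqT sum0.
rewrite negb_exists_in => /forall_inP g_gt0.
have ag_gt0 i : P i -> 0 < a i * g i.
  by move=> /g_gt0; rewrite -ltNge => gi; rewrite mulr_gt0.
rewrite gt_eqF// (bigD1 i0)//= ltr_pwDl ?ag_gt0// sumr_ge0// => i /andP[Pi _].
exact/ltW/ag_gt0.
Qed.

Lemma shifted_square_midpoint {R : realFieldType} (m v x y z : R) :
  x < y -> y < z -> (x - m) ^+ 2 - v <= 0 -> (z - m) ^+ 2 - v <= 0 ->
  (y - m) ^+ 2 - v < 0.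
Proof.
move=> xy yz gx gz.
have h1 : (z - y) * ((x - m) ^+ 2 - v) <= 0 by rewrite mulr_ge0_le0// subr_ge0 ltW.
have h2 : (y - x) * ((z - m) ^+ 2 - v) <= 0 by rewrite mulr_ge0_le0// subr_ge0 ltW.
have h3 : 0 < (z - x) * ((z - y) * (y - x)).
  by rewrite !mulr_gt0// subr_gt0// (lt_trans xy).
rewrite -(pmulr_rlt0 _ (_ : 0 < z - x)) ?subr_gt0 ?(lt_trans xy)//.
(* A monic quadratic lies below its chord over [x, z] by exactly (z - y)(y - x) at y. *)
have -> : (z - x) * ((y - m) ^+ 2 - v) = (z - y) * ((x - m) ^+ 2 - v) +
  (y - x) * ((z - m) ^+ 2 - v) - (z - x) * ((z - y) * (y - x)) by ring.
lra.
Qed.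

Lemma is_derive_affine {R : realType} (a b : R) :
  is_derive (0 : R) 1 (fun h : R => a + h * b) b.
Proof.
apply: is_derive_eq.
by rewrite add0r mul1r scaler0 add0r [b *: 1]mulr1.
Qed.

(** The exponents 1 and 0 are kept so that the three sums match [moment] and [tail_moment]
    syntactically. *)
Lemma sum_shifted_square {R : comNzRingType} {I : finType} (P : pred I)
    (x a : I -> R) (m v : R) :
  \sum_(i | P i) a i * ((x i - m) ^+ 2 - v) =
  \sum_(i | P i) x i ^+ 2 * a i - 2 * m * \sum_(i | P i) x i ^+ 1 * a i +
  (m ^+ 2 - v) * \sum_(i | P i) x i ^+ 0 * a i.
Proof.
rewrite !mulr_sumr -sumrN -!big_split /=.
by apply: eq_bigr => i _; rewrite expr0 expr1; ring.
Qed.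

Section Moments.
Context {R : realType} {n : nat} (u : R).
Implicit Types (r : 'rV[R]_n) (d : nat) (k : 'I_n).

Definition moment r d : R := \sum_(i < n.+1) i%:R ^+ d * coef u r i.

(** This is r_k times the k-th partial derivative of [moment r d]. *)
Definition tail_moment r k d : R :=
  \sum_(i < n.+1 | (k < i)%N) i%:R ^+ d * coef u r i.

Definition variance r : R :=
  moment r 2 / moment r 0 - (moment r 1 / moment r 0) ^+ 2.

Lemma moment0E r : \sum_(i < n.+1) coef u r i = moment r 0.
Proof. by apply: eq_bigr => i _; rewrite expr0 mul1r. Qed.

Lemma moment_weight r d :
  \sum_(i < n.+1) i%:R ^+ d * weight u r i = moment r d / moment r 0.
Proof.
rewrite [in RHS]/moment mulr_suml.
by apply: eq_bigr => i _; rewrite /weight moment0E mulrA.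
Qed.

Lemma meanE r : mean u r = moment r 1 / moment r 0.
Proof. by rewrite -moment_weight; apply: eq_bigr => i _; rewrite expr1. Qed.

Lemma qE r : q u r = (1 + u) ^+ 2 / (n%:R * u) * variance r.
Proof.
rewrite /q; congr (_ * _).
transitivity (\sum_(i < n.+1) weight u r i * ((i%:R - mean u r) ^+ 2 - 0)).
  by apply: eq_bigr => i _; rewrite subr0 mulrC.
rewrite sum_shifted_square !moment_weight meanE /variance subr0.
(* If the total mass is 0, its inverse is 0 by convention and both sides vanish, so the formula may
   be rewritten at every point of a line. *)
have [->|Z0] := eqVneq (moment r 0) 0; last by field.
by rewrite invr0 !mulr0; ring.
Qed.

(** The factor r_k occurs in a_i exactly when k < i, and then to the first power, so a_i is affine
    in r_k with slope a_i / r_k or 0. *)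
Lemma coef_line r k (h : R) i : r 0 k != 0 ->
  coef u (h *: delta_mx 0 k + r) i =
  coef u r i + h * ((k < i)%N%:R * coef u r i / r 0 k).
Proof.
move=> rk0; rewrite /coef.
have eqr (j : 'I_n) : j != k -> (h *: delta_mx 0 k + r) 0 j = r 0 j.
  by move=> /negbTE jk; rewrite !mxE eqxx jk mulr0 add0r.
have [ki|ik] := ltnP k i; last first.
  rewrite mul0r mul0r mulr0 addr0; congr (_ * _ * _).
  apply: eq_bigr => j ji; apply: eqr; apply: contraTneq ji => ->.
  by rewrite -leqNgt.
rewrite (bigD1 k)//= [in RHS](bigD1 k)//=.
under eq_bigr => j /andP[_ jk] do rewrite eqr//.
by rewrite !mxE !eqxx /=; field.
Qed.

Lemma moment_line r k d (h : R) : r 0 k != 0 ->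
  moment (h *: delta_mx 0 k + r) d = moment r d + h * (tail_moment r k d / r 0 k).
Proof.
move=> rk0; rewrite /moment /tail_moment mulr_suml mulr_sumr [X in _ = _ + X]big_mkcond /=.
rewrite -big_split /=; apply: eq_bigr => i _; rewrite coef_line//.
by case: (k < i)%N => /=; ring.
Qed.

Lemma sum_centered r : moment r 0 != 0 ->
  \sum_(i < n.+1) coef u r i * ((i%:R - mean u r) ^+ 2 - variance r) = 0.
Proof.
move=> Z0; rewrite sum_shifted_square.
by rewrite -/(moment r 2) -/(moment r 1) -/(moment r 0) meanE /variance; field.
Qed.

(** Write M_d for the moments, T_d for the tail moments and V = M_2/M_0 - mu^2. Since M_d' = T_d /
    r_k, the quotient rule gives V' = (T_2 - 2 mu T_1 + (mu^2 - V) T_0) / (r_k M_0), where the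
    bracket is the expanded tail sum. *)
Lemma partial_qE r k : r 0 k != 0 -> moment r 0 != 0 ->
  'D_(delta_mx 0 k) (q u) r =
  (1 + u) ^+ 2 / (n%:R * u) / (r 0 k * moment r 0) *
  \sum_(i < n.+1 | (k < i)%N) coef u r i * ((i%:R - mean u r) ^+ 2 - variance r).
Proof.
move=> rk0 Z0; rewrite derive_line.
pose L d h : R := moment r d + h * (tail_moment r k d / r 0 k).
have dL d : is_derive (0 : R) 1 (L d) (tail_moment r k d / r 0 k).
  exact: is_derive_affine.
have L0 d : L d 0 = moment r d by rewrite /L mul0r addr0.
set C := (1 + u) ^+ 2 / (n%:R * u).
pose LV h := (L 0 h)^-1.
have dLV : is_derive (0 : R) 1 LV (- (L 0 0) ^- 2 *: (tail_moment r k 0 / r 0 k)).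
  by apply: is_deriveV; rewrite L0.
have -> : (fun h => q u (h *: delta_mx 0 k + r)) =
    C \*: (L 2%N * LV - (L 1%N * LV) ^+ 2).
  by apply/funext => h; rewrite qE /variance !moment_line.
rewrite derive_val sum_shifted_square.
rewrite -/(tail_moment r k 2) -/(tail_moment r k 1) -/(tail_moment r k 0).
rewrite meanE /variance mulrfctE /LV !L0 /GRing.scale /=; clearbody C; field.
by rewrite Z0.
Qed.

End Moments.

Theorem proposition2 (R : realType) (n : nat) (Omega : R)
    (S : {set 'I_n}) (c : 'rV[R]_n) (u : R)
    (hn : (2 <= n)%N) (hOmega : 1 <= Omega)
    (hc : forall k : 'I_n, k \notin S -> c 0 k = Omega^-1 \/ c 0 k = Omega)
    (hS : (2 <= #|S|)%N) (hu : 0 < u) :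
  ~ exists r : 'rV[R]_n,
      face_relint Omega S c r /\ critical_point S (q u) r.
Proof.
move=> [r [[[rbox _] _] crit]].
have r_gt0 k : 0 < r 0 k.
  have /andP[+ _] := rbox k; apply: lt_le_trans.
  by rewrite invr_gt0 (lt_le_trans ltr01).
have a_gt0 (i : 'I_n.+1) : 0 < coef u r i.
  rewrite /coef !mulr_gt0 ?exprn_gt0 ?prodr_gt0//.
  by rewrite ltr0n bin_gt0 -ltnS.
have Z_gt0 : 0 < moment u r 0.
  rewrite -moment0E big_ord_recl ltr_pwDl ?a_gt0// sumr_ge0// => i _.
  exact/ltW/a_gt0.
pose g (i : 'I_n.+1) := (i%:R - mean u r) ^+ 2 - variance u r.
have tail0 k : k \in S -> \sum_(i < n.+1 | (k < i)%N) coef u r i * g i = 0.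
  move=> /crit; rewrite partial_qE ?gt_eqF//; move/eqP.
  rewrite mulf_eq0 gt_eqF => [/eqP//|].
  rewrite !(divr_gt0, mulr_gt0, exprn_gt0) ?ltr0n ?addr_gt0//.
  exact: leq_trans hn.
have [k [l [kS lS kl]]] : exists k l, [/\ k \in S, l \in S & (k < l)%N].
  have /card_gt1P[k [l [kS lS]]] := hS.
  by rewrite neq_ltn => /orP[kl|lk]; [exists k, l | exists l, k].
have := sum_centered u r (negbT (gt_eqF Z_gt0)).
(* Total minus tail beyond k: the block i <= k sums to 0. *)
rewrite (bigID (fun i : 'I_n.+1 => (k < i)%N)) /= tail0// add0r => head0.
have := tail0 k kS.
(* Tail beyond k minus tail beyond l: the block k < i <= l sums to 0. *)
rewrite (bigID (fun i : 'I_n.+1 => (l < i)%N)) /=.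
under eq_bigl => i do rewrite andbC andb_idr => [|/(ltn_trans kl)//].
rewrite tail0// add0r => mid0.
(* The indices 0, n and l show that the first, last and middle blocks are nonempty. *)
have [|x xk gx] := exists_le0_of_sum0 (i0 := ord0) _ a_gt0 head0; first by [].
have [|z lz gz] := exists_le0_of_sum0 (i0 := ord_max) _ a_gt0 (tail0 l lS).
  exact: ltn_ord.
(* Applied to -g, the lemma yields an index of the middle block with g >= 0. *)
have [||y /andP[ky yl] gy] := exists_le0_of_sum0 (g := fun i => - g i)
  (P := fun i : 'I_n.+1 => (k < i)%N && ~~ (l < i)%N)
  (i0 := widen_ord (leqnSn n) l) _ a_gt0.
- by rewrite /= kl ltnn.
- by under eq_bigr do rewrite mulrN; rewrite sumrN mid0 oppr0.
(* The blocks give x <= k < y <= l < z, so convexity forces g(y) < 0. *)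
have xy : (x < y)%N by apply: leq_ltn_trans ky; rewrite leqNgt.
have yz : (y < z)%N by apply: leq_ltn_trans lz; rewrite leqNgt.
have := @shifted_square_midpoint _ (mean u r) (variance u r) x%:R y%:R z%:R.
rewrite !ltr_nat => /(_ xy yz gx gz) gy_lt0.
by move: gy; rewrite oppr_le0 leNgt gy_lt0.
Qed.
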